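(* Let $A\in\mathbb{R}^{m\times n}$ ($m\ll n$), let $k$ be a positive integer, and let $y:=Ax+\eta$, where $x\in\mathbb{R}^n$ is $k$-compressible, $\eta\in\mathbb{R}^m$ and $S=\mathcal{L}_k(x)$. Let $q\ge k$ be a positive integer and let $\varphi=\frac{\sqrt5+1}{2}$. Suppose that the restricted isometry constants of $A$ satisfy $$\delta_{\max\{q,3k\}}<\frac{-(1+6\varphi)+\sqrt{(1+6\varphi)^2+12\varphi\sqrt{\lceil\frac nk\rceil}}}{6\varphi\sqrt{\lceil\frac nk\rceil}}.$$ Let $\lambda$ be chosen such that $$(1+\delta_q)\left(1-\frac{\frac1{3\varphi}(1-\delta_{2k})-\delta_{3k}}{1+\sqrt{\lceil\frac nk\rceil}\,\delta_{3k}}\right)<\lambda<(1-\delta_q)\left(1+\frac{\frac1{3\varphi}(1-\delta_{2k})-\delta_{3k}}{1+\sqrt{\lceil\frac nk\rceil}\,\delta_{3k}}\right),$$ and let the parameters $\alpha,\gamma>0$ satisfy $\frac1{1+\delta_q}\le\alpha\gamma\le\frac1{1-\delta_q}$. Then the sequence $\{x^{(p)}\}$ generated by the CNOTP algorithm (with input $A,y,k,q,\lambda,\alpha,\gamma$) satisfies, for every $p\ge0$, $$\|x^{(p+1)}-x_S\|_2\le\rho_4\|x^{(p)}-x_S\|_2+\tau_4\|\eta'\|_2,$$ where $\eta'=Ax_{\overline S}+\eta$, $$\rho_4:=\frac{3\varphi}{1-\delta_{2k}}\left(\delta_{3k}+\Delta(\lambda,\delta_q)\left(1+\sqrt{\lceil\tfrac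 nk\rceil}\,\delta_{3k}\right)\right),$$ $$\tau_4:=\frac{3\lambda\varphi(1+\delta_k)\sqrt{\lceil\frac nk\rceil}}{(1-\delta_q)(1-\delta_{2k})\sqrt{1+\delta_{2k}}}+\frac{2\varphi}{(1-\delta_{2k})\sqrt{1+\delta_{2k}}}+\frac{\sqrt{1+\delta_k}}{1-\delta_{2k}},$$ $$\Delta(\lambda,\delta_q):=\max\left\{\left|1-\tfrac{\lambda}{1-\delta_q}\right|,\left|1-\tfrac{\lambda}{1+\delta_q}\right|\right\},$$ and $\rho_4<1$. Moreover, $\{x^{(p)}\}$ converges to $x_S$ when $\eta'=0$.
   Context: Restricted isometry constant: for a positive integer $t$, $\delta_t$ is the smallest $\delta\in[0,1)$ such that $(1-\delta)\|z\|_2^2\le\|Az\|_2^2\le(1+\delta)\|z\|_2^2$ for all $t$-sparse $z\in\mathbb{R}^n$ (vectors with at most $t$ nonzero entries); a bound on $\delta_t$ includes the requirement that such a constant exists. Note that $\delta_t$ is nondecreasing in $t$. Notation: $\mathcal{H}_k(z)$ keeps the $k$ largest-magnitude entries of $z$ and sets the others to zero (ties broken by any fixed rule); $\mathcal{L}_k(z)$ is the support of $\mathcal{H}_k(z)$. For an index set $\Omega\subseteq\{1,\dots,n\}$, $\overline\Omega$ is its complement, $A_\Omega$ is the submatrix of columns of $A$ indexed by $\Omega$, and for a vector $x$, $x_\Omega\in\mathbb{R}^n$ (used as an argument of $A$ or compared with vectors in $\mathbb{R}^n$) equals $x$ on $\Omega$ and is zero elsewhere. Thus $x_S$ is the best $k$-term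 approximation of $x$. ''$k$-compressible'' is an informal term (well approximated by a $k$-sparse vector, not necessarily exactly $k$-sparse) and imposes no quantitative condition on $x$. $\mathbf e$ is the all-ones vector, $\otimes$ is the entrywise (Hadamard) product of vectors, and vector inequalities are entrywise. For $\Omega\subseteq\{1,\dots,n\}$ and parameters $\alpha,\gamma>0$: $M(\Omega)\in\mathbb{R}^{n\times n}$ is the matrix with principal submatrix $M(\Omega)_{\Omega\times\Omega}=(A_\Omega^\top A_\Omega)^{-1}$, diagonal entries $[M(\Omega)]_{ii}=\alpha$ for $i\notin\Omega$, and all other entries zero; $Z(\Omega)=\operatorname{diag}(z_1,\dots,z_n)$ with $z_i=1$ for $i\in\Omega$ and $z_i=\gamma$ for $i\notin\Omega$. CNOTP algorithm (compressed Newton-direction-based optimal thresholding pursuit): start from $x^{(0)}=\mathbf 0$. For $p=0,1,2,\dots$: let $\Omega^p=\mathcal{L}_q(A^\top(y-Ax^{(p)}))$, set $u^{(p)}=x^{(p)}+\lambda M(\Omega^p)Z(\Omega^p)A^\top(y-Ax^{(p)})$, let $w^{(p)}$ be a minimizer of $\|y-A(w\otimes u^{(p)})\|_2^2$ over $\{w\in\mathbb{R}^n:\mathbf e^\top w=k,\ \mathbf 0\le w\le\mathbf e\}$, set $S^{(p+1)}=\operatorname{supp}(\mathcal{H}_k(w^{(p)}\otimes u^{(p)}))$, and $x^{(p+1)}=\arg\min_z\{\|y-Az\|_2^2:\operatorname{supp}(z)\subseteq S^{(p+1)}\}$. *)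

(* Defs.v *)
From HB Require Import structures.
From mathcomp Require Import all_boot all_order all_algebra.
From mathcomp Require Import all_classical all_reals all_analysis.
Set Implicit Arguments.
Unset Strict Implicit.
Unset Printing Implicit Defensive.
Import Order.TTheory GRing.Theory Num.Theory.
Import numFieldNormedType.Exports.
Local Open Scope ring_scope.

Section Vectors.
Context {R : realType}.

Definition norm2 n (z : 'cV[R]_n) : R := Num.sqrt (\sum_i z i 0 ^+ 2).

Definition supp n (z : 'cV[R]_n) : {set 'I_n} := [set i | z i 0 != 0]%SET.

Definition restr n (Om : {set 'I_n}) (z : 'cV[R]_n) : 'cV[R]_n :=
  \col_i (if i \in Om then z i 0 else 0).

Definition hadamard n (w u : 'cV[R]_n) : 'cV[R]_n := \col_i (w i 0 * u i 0).

Definition minimizer T (D : set T) (f : T -> R) (w : T) : Prop :=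
  D w /\ forall v, D v -> f w <= f v.

(* A deterministic way of breaking ties: [top t z] is an index set of t
   largest entries of z in magnitude (all indices when n < t). *)
Definition top_rule n (top : nat -> 'cV[R]_n -> {set 'I_n}) : Prop :=
  forall t z, #|top t z| = minn t n /\
    forall i j, i \in top t z -> j \notin top t z -> `|z j 0| <= `|z i 0|.

Definition hardthr n (top : nat -> 'cV[R]_n -> {set 'I_n}) t (z : 'cV[R]_n)
  : 'cV[R]_n := restr (top t z) z.

(* The support of the thresholded vector: it has fewer than t elements when z
   has fewer than t nonzero entries. *)
Definition topsupp n (top : nat -> 'cV[R]_n -> {set 'I_n}) t (z : 'cV[R]_n)
  : {set 'I_n} := supp (hardthr top t z).

End Vectors.

Section RestrictedIsometry.
Context {R : realType} {m n : nat}.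
Implicit Types (A : 'M[R]_(m, n)) (t : nat) (d : R).

Definition rip A t d : Prop := 0 <= d < 1 /\
  forall z : 'cV[R]_n, (#|supp z| <= t)%N ->
    (1 - d) * norm2 z ^+ 2 <= norm2 (A *m z) ^+ 2 <= (1 + d) * norm2 z ^+ 2.

Definition is_ric A t d : Prop := rip A t d /\ forall d', rip A t d' -> d <= d'.

Definition has_ric A t : Prop := exists d, is_ric A t d.

(* The value 1 is a dummy, used only when no constant in [0, 1) exists. *)
Definition ric A t : R := xget 1 [set d | is_ric A t d]%classic.

End RestrictedIsometry.

Section Algorithm.
Context {R : realType} {m n : nat}.
Implicit Types (A : 'M[R]_(m, n)) (y : 'cV[R]_m) (Om : {set 'I_n}).

Definition colset A Om : 'M[R]_(m, #|Om|) :=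
  colsub (fun a : 'I_#|Om| => enum_val a) A.

(* The position of i in the enumeration of Om, None if i is not in Om. *)
Definition pos_in Om (i : 'I_n) : option 'I_#|Om| :=
  [pick a : 'I_#|Om| | enum_val a == i].

Definition Mmx A (alpha : R) Om : 'M[R]_n :=
  let G := invmx ((colset A Om)^T *m colset A Om) in
  \matrix_(i, j)
    match pos_in Om i, pos_in Om j with
    | Some a, Some b => G a b
    | None, None => if i == j then alpha else 0
    | _, _ => 0
    end.

Definition Zmx (gamma : R) Om : 'M[R]_n :=
  diag_mx (\row_i (if i \in Om then 1 else gamma)).

Definition relaxed_selectors (k : nat) : set 'cV[R]_n :=
  [set w | \sum_i w i 0 = k%:R /\ forall i, 0 <= w i 0 <= 1]%classic.

(* A relation and not a function, since the minimizer w need not be unique. *)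
Definition cnotp_step (top : nat -> 'cV[R]_n -> {set 'I_n})
    A y (k q : nat) (lambda alpha gamma : R) (xp xp1 : 'cV[R]_n) : Prop :=
  let g := A^T *m (y - A *m xp) in
  let Om := topsupp top q g in
  let u := xp + lambda *: (Mmx A alpha Om *m Zmx gamma Om *m g) in
  exists w : 'cV[R]_n,
    minimizer (relaxed_selectors k)
      (fun v => norm2 (y - A *m hadamard v u) ^+ 2) w /\
    let Sp1 := supp (hardthr top k (hadamard w u)) in
    minimizer [set z | supp z \subset Sp1]%classic
      (fun z => norm2 (y - A *m z) ^+ 2) xp1.

Definition cnotp_sequence (top : nat -> 'cV[R]_n -> {set 'I_n})
    A y (k q : nat) (lambda alpha gamma : R) (xs : nat -> 'cV[R]_n) : Prop :=
  xs 0%N = 0 /\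
  forall p, cnotp_step top A y k q lambda alpha gamma (xs p) (xs p.+1).

End Algorithm.

Section Constants.
Context {R : realType}.

Definition phi : R := (Num.sqrt 5 + 1) / 2.

Definition ceil_ratio (n k : nat) : R := (Num.ceil (n%:R / k%:R : R))%:~R.

Definition Delta (lambda d : R) : R :=
  Num.max `|1 - lambda / (1 - d)| `|1 - lambda / (1 + d)|.

Definition ric_bound (n k : nat) : R :=
  (- (1 + 6 * phi)
     + Num.sqrt ((1 + 6 * phi) ^+ 2 + 12 * phi * Num.sqrt (ceil_ratio n k)))
  / (6 * phi * Num.sqrt (ceil_ratio n k)).

Context {m n : nat}.
Implicit Types (A : 'M[R]_(m, n)).

Definition step_margin A (k : nat) : R :=
  ((3 * phi)^-1 * (1 - ric A (2 * k)) - ric A (3 * k))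
  / (1 + Num.sqrt (ceil_ratio n k) * ric A (3 * k)).

Definition rho4 A (k q : nat) (lambda : R) : R :=
  3 * phi / (1 - ric A (2 * k))
  * (ric A (3 * k)
     + Delta lambda (ric A q)
       * (1 + Num.sqrt (ceil_ratio n k) * ric A (3 * k))).

Definition tau4 A (k q : nat) (lambda : R) : R :=
  3 * lambda * phi * (1 + ric A k) * Num.sqrt (ceil_ratio n k)
    / ((1 - ric A q) * (1 - ric A (2 * k)) * Num.sqrt (1 + ric A (2 * k)))
  + 2 * phi / ((1 - ric A (2 * k)) * Num.sqrt (1 + ric A (2 * k)))
  + Num.sqrt (1 + ric A k) / (1 - ric A (2 * k)).

End Constants.

(* Main.v *)
(* Let x_S = [restr S x], v = x^(p) - x_S and D = M(Omega) Z(Omega).  The matrix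
   D is symmetric with quadratic form between 1/(1+delta_q) and 1/(1-delta_q), so
   the Newton step moves the error u - x_S, on every k-element set, by at most
   (delta_3k + Delta (1 + sqrt(ceil(n/k)) delta_3k)) |v| plus noise; the factor
   sqrt(ceil(n/k)) comes from cutting A^T A v into blocks of length k.
   The map w |-> |A (w * z)| on the polytope of relaxed selectors is controlled by
   its values on k-element sets: |A (w * z)|^2 is linear in w once one of the two
   factors is frozen, and a linear functional is maximized by an indicator.
   Comparing w^(p) with the indicator of the k largest entries of x then bounds
   x_S - w * u on the union of this set with the thresholding support.  Hard
   thresholding costs the golden ratio phi, the largest singular value of the
   2 x 2 matrix [[1, 1], [0, 1]], and the least-squares projection onto the new
   support costs 1/sqrt(1 - delta_2k^2). *)

Require Import Defs.
From HB Require Import structures.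
From mathcomp Require Import all_boot all_order all_algebra.
From mathcomp Require Import all_classical all_reals all_analysis.
From mathcomp Require Import ring lra.
Set Implicit Arguments.
Unset Strict Implicit.
Unset Printing Implicit Defensive.
Import Order.TTheory GRing.Theory Num.Theory.
Import numFieldNormedType.Exports.
Local Open Scope classical_set_scope.
Local Open Scope ring_scope.

(** * Inner products, supports and restrictions in Euclidean space *)

Section Euclidean.
Context {R : realType}.

Definition dot n (u v : 'cV[R]_n) : R := \sum_i u i 0 * v i 0.

Lemma dotC n (u v : 'cV[R]_n) : dot u v = dot v u.
Proof. by apply: eq_bigr => i _; rewrite mulrC. Qed.

Lemma dotDr n (u v w : 'cV[R]_n) : dot u (v + w) = dot u v + dot u w.
Proof. by rewrite -big_split; apply: eq_bigr => i _; rewrite !mxE mulrDr. Qed.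

Lemma dotZr n a (u v : 'cV[R]_n) : dot u (a *: v) = a * dot u v.
Proof. by rewrite big_distrr; apply: eq_bigr => i _ /=; rewrite !mxE mulrCA. Qed.

Lemma dotNr n (u v : 'cV[R]_n) : dot u (- v) = - dot u v.
Proof. by rewrite -scaleN1r dotZr mulN1r. Qed.

Lemma dotBr n (u v w : 'cV[R]_n) : dot u (v - w) = dot u v - dot u w.
Proof. by rewrite dotDr dotNr. Qed.

Lemma dotDl n (u v w : 'cV[R]_n) : dot (u + v) w = dot u w + dot v w.
Proof. by rewrite dotC dotDr !(dotC w). Qed.

Lemma dotZl n a (u v : 'cV[R]_n) : dot (a *: u) v = a * dot u v.
Proof. by rewrite dotC dotZr dotC. Qed.

Lemma dotBl n (u v w : 'cV[R]_n) : dot (u - v) w = dot u w - dot v w.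
Proof. by rewrite dotC dotBr !(dotC w). Qed.

Lemma dot_mulmxl m n (A : 'M[R]_(m, n)) u v :
  dot (A *m u) v = dot u (A^T *m v).
Proof.
rewrite /dot; under eq_bigr do rewrite mxE big_distrl.
under [RHS]eq_bigr do rewrite mxE big_distrr.
rewrite exchange_big; apply: eq_bigr => i _; apply: eq_bigr => j _.
by rewrite !mxE /=; ring.
Qed.

Lemma dot_ge0 n (u : 'cV[R]_n) : 0 <= dot u u.
Proof. by apply: sumr_ge0 => i _; rewrite -expr2 sqr_ge0. Qed.

Lemma norm2_sq n (u : 'cV[R]_n) : norm2 u ^+ 2 = dot u u.
Proof.
by rewrite sqr_sqrtr; [apply: eq_bigr|apply: sumr_ge0] => i _;
   rewrite ?sqr_ge0.
Qed.

Lemma norm2_ge0 n (u : 'cV[R]_n) : 0 <= norm2 u.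
Proof. exact: sqrtr_ge0. Qed.

Lemma norm2_le n (u : 'cV[R]_n) b : 0 <= b -> dot u u <= b ^+ 2 -> norm2 u <= b.
Proof. by rewrite -norm2_sq => b0; rewrite ler_sqr ?nnegrE ?norm2_ge0. Qed.

Lemma norm2_eq0 n (u : 'cV[R]_n) : norm2 u = 0 -> u = 0.
Proof.
move=> u0; have /eqP : dot u u = 0 by rewrite -norm2_sq u0 expr0n.
rewrite psumr_eq0 => [/allP h|i _]; last by rewrite -expr2 sqr_ge0.
apply/colP => i; rewrite mxE; apply/eqP.
by have := h i (mem_index_enum _); rewrite /= mulf_eq0 orbb.
Qed.

Lemma norm2Z n a (u : 'cV[R]_n) : norm2 (a *: u) = `|a| * norm2 u.
Proof.
apply/eqP; rewrite -(@eqrXn2 _ 2) ?mulr_ge0 ?norm2_ge0 //; apply/eqP.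
by rewrite exprMn real_normK ?num_real // !norm2_sq dotZl dotZr mulrA.
Qed.

Lemma norm2_0 n : norm2 (0 : 'cV[R]_n) = 0.
Proof. by rewrite -(scale0r 0) norm2Z normr0 mul0r. Qed.

Lemma norm2N n (u : 'cV[R]_n) : norm2 (- u) = norm2 u.
Proof. by rewrite -scaleN1r norm2Z normrN1 mul1r. Qed.

Lemma dot_le_norm2 n (u v : 'cV[R]_n) : dot u v <= norm2 u * norm2 v.
Proof.
have [v0|vn0] := eqVneq (norm2 v) 0.
  by rewrite v0 (norm2_eq0 v0) -[X in dot _ X](scale0r 0) dotZr mul0r mulr0.
have v_gt0 : 0 < norm2 v by rewrite lt_neqAle eq_sym vn0 norm2_ge0.
have := dot_ge0 (norm2 v *: u - norm2 u *: v).
rewrite dotBl !dotBr !dotZl !dotZr -!norm2_sq (dotC v u) => h.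
have [u0|un0] := eqVneq (norm2 u) 0.
  by rewrite u0 (norm2_eq0 u0) dotC -[X in dot _ X](scale0r 0) dotZr !mul0r.
have u_gt0 : 0 < norm2 u by rewrite lt_neqAle eq_sym un0 norm2_ge0.
have : 0 <= (norm2 u * norm2 v * 2) * (norm2 u * norm2 v - dot u v).
  by apply: le_trans h _; rewrite le_eqVlt; apply/orP; left; apply/eqP; ring.
by rewrite pmulr_rge0 ?subr_ge0 // !mulr_gt0.
Qed.

Lemma norm2D n (u v : 'cV[R]_n) : norm2 (u + v) <= norm2 u + norm2 v.
Proof.
apply: norm2_le; first by rewrite addr_ge0 ?norm2_ge0.
rewrite dotDl !dotDr -!norm2_sq (dotC v u) sqrrD.
by have := dot_le_norm2 u v; lra.
Qed.

Lemma norm2B n (u v : 'cV[R]_n) : norm2 (u - v) <= norm2 u + norm2 v.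
Proof. by rewrite -(norm2N v) norm2D. Qed.

Lemma suppP n (T : {set 'I_n}) (u : 'cV[R]_n) :
  reflect (forall i, i \notin T -> u i 0 = 0) (supp u \subset T).
Proof.
apply: (iffP fintype.subsetP) => h i; last first.
  by rewrite inE; apply: contraNT => /h /eqP.
by move=> iT; apply/eqP/(contraNT _ iT) => ui; apply: h; rewrite inE.
Qed.

Lemma supp_restr n (T : {set 'I_n}) (u : 'cV[R]_n) : supp (restr T u) \subset T.
Proof. by apply/suppP => i /negbTE iT; rewrite mxE iT. Qed.

Lemma restr_id n (T : {set 'I_n}) (u : 'cV[R]_n) :
  supp u \subset T -> restr T u = u.
Proof. by move/suppP => h; apply/colP => i; rewrite mxE; case: ifPn => // /h. Qed.

Lemma suppD n (T : {set 'I_n}) (u v : 'cV[R]_n) :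
  supp u \subset T -> supp v \subset T -> supp (u + v) \subset T.
Proof.
by move=> /suppP hu /suppP hv; apply/suppP => i iT; rewrite mxE hu ?hv ?addr0.
Qed.

Lemma suppZ n (T : {set 'I_n}) a (u : 'cV[R]_n) :
  supp u \subset T -> supp (a *: u) \subset T.
Proof. by move=> /suppP hu; apply/suppP => i iT; rewrite mxE hu ?mulr0. Qed.

Lemma suppB n (T : {set 'I_n}) (u v : 'cV[R]_n) :
  supp u \subset T -> supp v \subset T -> supp (u - v) \subset T.
Proof. by move=> hu hv; rewrite -scaleN1r suppD ?suppZ. Qed.

Lemma card_supp n (T : {set 'I_n}) (u : 'cV[R]_n) t :
  supp u \subset T -> (#|T| <= t)%N -> (#|supp u| <= t)%N.
Proof. by move=> /subset_leq_card; apply: leq_trans. Qed.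

Lemma restrD n (T : {set 'I_n}) (u v : 'cV[R]_n) :
  restr T (u + v) = restr T u + restr T v.
Proof. by apply/colP => i; rewrite !mxE; case: ifP; rewrite ?addr0. Qed.

Lemma restrCD n (T : {set 'I_n}) (u : 'cV[R]_n) :
  u = restr T u + restr (~: T)%SET u.
Proof. by apply/colP => i; rewrite !mxE inE; case: ifP; rewrite ?addr0 ?add0r. Qed.

Lemma dot_restr n (T : {set 'I_n}) (u v : 'cV[R]_n) :
  dot (restr T u) v = \sum_(i in T) u i 0 * v i 0.
Proof.
rewrite [RHS]big_mkcond; apply: eq_bigr => i _; rewrite mxE.
by case: ifP; rewrite ?mul0r.
Qed.

Lemma dot_restrK n (T : {set 'I_n}) (u v : 'cV[R]_n) :
  dot (restr T u) (restr T v) = dot (restr T u) v.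
Proof. by rewrite !dot_restr; apply: eq_bigr => i iT; rewrite mxE iT. Qed.

Lemma norm2_restr_sq n (T : {set 'I_n}) (u : 'cV[R]_n) :
  norm2 (restr T u) ^+ 2 = \sum_(i in T) u i 0 ^+ 2.
Proof. by rewrite norm2_sq dot_restrK dot_restr. Qed.

Lemma norm2_restrCD n (T : {set 'I_n}) (u : 'cV[R]_n) :
  norm2 u ^+ 2 = norm2 (restr T u) ^+ 2 + norm2 (restr (~: T)%SET u) ^+ 2.
Proof.
rewrite !norm2_restr_sq norm2_sq [LHS](bigID (mem T)) /=; congr (_ + _).
by apply: eq_bigl => i; rewrite inE.
Qed.

Lemma norm2_restr_le n (T : {set 'I_n}) (u : 'cV[R]_n) :
  norm2 (restr T u) <= norm2 u.
Proof.
apply: norm2_le; rewrite ?norm2_ge0 // -norm2_sq (norm2_restrCD T u).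
by rewrite lerDl sqr_ge0.
Qed.

Lemma norm2_entry n (u : 'cV[R]_n) i : `|u i 0| <= norm2 u.
Proof.
rewrite -ler_sqr ?nnegrE ?norm2_ge0 // real_normK ?num_real // norm2_sq.
rewrite /dot (bigD1 i) //= -expr2 lerDl.
by apply: sumr_ge0 => j _; rewrite -expr2 sqr_ge0.
Qed.

(* Polarization between [|v| u + |u| v] and [|v| u - |u| v]. *)
Lemma sym_form_le n (K : 'M[R]_n) (T : {set 'I_n}) d (u v : 'cV[R]_n) :
  (forall u v, dot u (K *m v) = dot v (K *m u)) ->
  (forall z, supp z \subset T -> `|dot z (K *m z)| <= d * norm2 z ^+ 2) ->
  supp u \subset T -> supp v \subset T ->
  dot u (K *m v) <= d * norm2 u * norm2 v.
Proof.
move=> symK hK hu hv.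
have [v0|vn0] := eqVneq (norm2 v) 0.
  by rewrite v0 (norm2_eq0 v0) symK -[X in dot X _](scale0r 0) dotZl mul0r mulr0.
have [u0|un0] := eqVneq (norm2 u) 0.
  by rewrite u0 (norm2_eq0 u0) -[X in dot X _](scale0r 0) dotZl mulr0 !mul0r.
have v_gt0 : 0 < norm2 v by rewrite lt_neqAle eq_sym vn0 norm2_ge0.
have u_gt0 : 0 < norm2 u by rewrite lt_neqAle eq_sym un0 norm2_ge0.
set a := norm2 v in v_gt0 *; set b := norm2 u in u_gt0 *.
have hp := hK (a *: u + b *: v) (suppD (suppZ a hu) (suppZ b hv)).
have hm := hK (a *: u - b *: v) (suppB (suppZ a hu) (suppZ b hv)).
have {hp} /ler_normlP[_ hp] := hp; have {hm} /ler_normlP[hm _] := hm.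
rewrite norm2_sq mulmxDr -!scalemxAr !(dotDl, dotDr, dotZl, dotZr) in hp.
rewrite norm2_sq mulmxBr -!scalemxAr !(dotBl, dotBr, dotZl, dotZr) in hm.
rewrite (symK v u) (dotC v u) -!norm2_sq -/a -/b in hp hm.
have ab : 0 < a * b * 4 by rewrite !mulr_gt0.
by rewrite -(ler_pM2l ab); lra.
Qed.

(** Testing the bilinear form against [h = restr L (K *m v)] itself produces [norm2 h ^+ 2], and one
    factor [norm2 h] cancels. With [T] and [L] full, a bound on a quadratic form becomes an operator
    norm bound. *)
Lemma sym_form_restr n (K : 'M[R]_n) (T L : {set 'I_n}) d (v : 'cV[R]_n) :
  0 <= d ->
  (forall u v, dot u (K *m v) = dot v (K *m u)) ->
  (forall z, supp z \subset T -> `|dot z (K *m z)| <= d * norm2 z ^+ 2) ->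
  L \subset T -> supp v \subset T ->
  norm2 (restr L (K *m v)) <= d * norm2 v.
Proof.
move=> d0 symK hK LT vT; set h := restr L _.
have hT : supp h \subset T by apply: fintype.subset_trans (supp_restr _ _) LT.
have := sym_form_le symK hK hT vT.
rewrite (_ : dot h _ = norm2 h ^+ 2); last by rewrite norm2_sq /h dot_restrK.
have [h0|hn0] := eqVneq (norm2 h) 0; first by rewrite h0 mulr_ge0 ?norm2_ge0.
have h_gt0 : 0 < norm2 h by rewrite lt_neqAle eq_sym hn0 norm2_ge0.
by rewrite expr2 -mulrA mulrCA ler_pM2l.
Qed.

(* Group the indices by [i %/ k]. *)
Lemma norm2_blocks n k (z : 'cV[R]_n) b : (0 < k)%N -> 0 <= b ->
  (forall L : {set 'I_n}, (#|L| <= k)%N -> norm2 (restr L z) <= b) ->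
  norm2 z <= Num.sqrt (ceil_ratio n k) * b.
Proof.
move=> k0 b0 hb.
have nk0 : 0 <= n%:R / k%:R :> R by rewrite divr_ge0 ?ler0n.
(* The ceiling is an integer, and nonnegativity of the ratio makes it a natural number [c], which
   serves as the number of blocks. *)
have [c cE] : exists c : nat, Num.ceil (n%:R / k%:R : R) = c.
  case E : (Num.ceil _) => [c|c]; first by exists c.
  have := ceil_ge0 (n%:R / k%:R : R); rewrite E.
  by rewrite (lt_le_trans _ nk0) // ltrN10.
have cr : ceil_ratio n k = c%:R :> R by rewrite /ceil_ratio cE.
have nck : (n <= c * k)%N.
  have := ceil_ge (n%:R / k%:R : R); rewrite cE ler_pdivrMr ?ltr0n //.
  by rewrite -pmulrn -natrM ler_nat.
apply: norm2_le; first by rewrite mulr_ge0 ?sqrtr_ge0.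
rewrite exprMn sqr_sqrtr cr ?ler0n //.
have blk (i : 'I_n) : (i %/ k < c)%N.
  by rewrite ltn_divLR // (leq_trans (ltn_ord i)).
rewrite /dot (partition_big (fun i => Ordinal (blk i)) xpredT) //=.
apply: (@le_trans _ _ (\sum_(j < c) b ^+ 2)); last first.
  by rewrite sumr_const card_ord mulr_natl.
apply: ler_sum => j _.
set L := [set i : 'I_n | Ordinal (blk i) == j]%SET.
(* Inside a block the quotient is fixed, so the remainder modulo [k] is injective. *)
have Lk : (#|L| <= k)%N.
  pose f (i : 'I_n) : 'I_k := Ordinal (ltn_pmod i k0).
  rewrite -[leqRHS]card_ord; apply: (@leq_card_in _ _ f L) => i1 i2.
  rewrite !inE => /eqP e1 /eqP e2 /(congr1 val) /= e.
  apply: val_inj; rewrite /= (divn_eq i1 k) (divn_eq i2 k) e.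
  by have /(congr1 val) /= -> : Ordinal (blk i1) = Ordinal (blk i2) by rewrite e1.
have := lerXn2r 2 (norm2_ge0 _) b0 (hb L Lk); rewrite norm2_restr_sq.
apply: le_trans; rewrite le_eqVlt; apply/orP; left; apply/eqP.
by apply: eq_big => i; rewrite ?inE // expr2.
Qed.

End Euclidean.

(** * Hard thresholding, and linear functionals on the relaxed selectors *)

Section Thresholding.
Context {R : realType} {n : nat}.
Implicit Types (f c : 'I_n -> R) (P Q S T L : {set 'I_n}) (x z w : 'cV[R]_n).

(** The minimum of [f] over [Q] separates the two sums: it lies above every term on [P] and below
    every term on [Q], and [Q] has at least as many terms. *)
Lemma ler_sum_dominated P Q f :
  (forall i, 0 <= f i) -> (#|P| <= #|Q|)%N ->
  (forall i j, i \in Q -> j \in P -> f j <= f i) ->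
  \sum_(j in P) f j <= \sum_(i in Q) f i.
Proof.
move=> f0 PQ h.
have [->|/set0Pn[j0 j0P]] := eqVneq P finset.set0.
  by rewrite big_set0 sumr_ge0.
have /card_gt0P[i0 i0Q] : (0 < #|Q|)%N.
  by apply: leq_trans PQ; apply/card_gt0P; exists j0.
case: (arg_minP f i0Q) => i1 i1Q hi1.
apply: (@le_trans _ _ (\sum_(j in P) f i1)).
  by apply: ler_sum => j jP; apply: h.
apply: (@le_trans _ _ (\sum_(j in Q) f i1)); last exact: ler_sum.
by rewrite !sumr_const ler_wpMn2l.
Qed.

Lemma phi_gt0 : 0 < phi :> R.
Proof. by rewrite divr_gt0 // ltr_wpDl ?sqrtr_ge0. Qed.

Lemma phi_sq : phi ^+ 2 = phi + 1 :> R.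
Proof.
have s5 : Num.sqrt 5 ^+ 2 = 5 :> R by rewrite sqr_sqrtr.
by rewrite /phi expr_div_n sqrrD s5; field.
Qed.

Lemma phi_gt1 : 1 < phi :> R.
Proof.
by rewrite -(ltr_pM2l phi_gt0) mulr1 -expr2 phi_sq ltrDl.
Qed.

(** On [S :\: T] the thresholded vector vanishes, so the error there is [(x - z) + z]. The mass of
    [z] on [S :\: T] is at most its mass on [T :\: S], where [x] vanishes and [z] is the error up to
    sign. The weights in Young's inequality balance these two regions through
    [phi ^+ 2 = phi + 1]. *)
Lemma hard_threshold_le S T x z :
  supp x \subset S -> (#|S| <= #|T|)%N ->
  (forall i j, i \in T -> j \notin T -> `|z j 0| <= `|z i 0|) ->
  norm2 (x - restr T z) <= phi * norm2 (restr (S :|: T) (x - z)).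
Proof.
move=> /suppP xS ST hT; have phi0 := @phi_gt0.
apply: norm2_le; first by rewrite mulr_ge0 ?norm2_ge0 // ltW.
rewrite exprMn -norm2_sq (norm2_restrCD (S :|: T)).
have -> : restr (~: (S :|: T)) (x - restr T z) = 0.
  apply/colP => i; rewrite !mxE !inE negb_or; case: ifPn => // /andP[iS iT].
  by rewrite (negbTE iT) xS // subr0.
rewrite norm2_0 expr0n addr0 !norm2_restr_sq.
have part g : \sum_(i in S :|: T) g i = \sum_(i in S :\: T) g i
    + \sum_(i in T :\: S) g i + \sum_(i in S :&: T) g i :> R.
  rewrite big_mkcond [X in _ = X + _ + _]big_mkcond [X in _ = _ + X + _]big_mkcond.
  rewrite [X in _ = _ + X]big_mkcond -!big_split; apply: eq_bigr => i _ /=.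
  by rewrite !inE; case: (i \in S); case: (i \in T); rewrite /= ?addr0 ?add0r.
rewrite !part.
(* Removing the common part [S :&: T] from both sets turns [#|S| <= #|T|] into a comparison of the
   two differences. *)
have dom : \sum_(i in S :\: T) z i 0 ^+ 2 <= \sum_(i in T :\: S) z i 0 ^+ 2.
  apply: ler_sum_dominated => [i||i j]; first exact: sqr_ge0.
    by move: ST; rewrite -(cardsID T S) -(cardsID S T) finset.setIC leq_add2l.
  rewrite !inE => /andP[iS iT] /andP[jT jS].
  by rewrite -[leLHS]real_normK ?num_real // -[leRHS]real_normK ?num_real //
             ler_sqr ?nnegrE ?hT.
have e1 : \sum_(i in S :\: T) (x - restr T z) i 0 ^+ 2
    <= phi ^+ 2 * (\sum_(i in S :\: T) (x - z) i 0 ^+ 2)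
       + phi * \sum_(i in S :\: T) z i 0 ^+ 2.
  (* Young: [(a + b)^2 <= (1 + phi) a^2 + (1 + 1/phi) b^2] *)
  rewrite !big_distrr -big_split /=; apply: ler_sum => i.
  rewrite !inE !mxE => /andP[/negbTE -> _]; rewrite subr0.
  have [a ->] : exists a, x i 0 = a + z i 0 by exists (x i 0 - z i 0); ring.
  rewrite addrK phi_sq; set b := z i 0.
  have p1 : phi ^+ 2 - phi - 1 = 0 :> R by rewrite phi_sq; ring.
  have -> : (phi + 1) * a ^+ 2 + phi * b ^+ 2 = (a + b) ^+ 2
      + (phi - 1) * (phi * a - b) ^+ 2
      + (phi ^+ 2 - phi - 1) * (2 * a * b - phi * a ^+ 2) by ring.
  by rewrite p1 mul0r addr0 lerDl mulr_ge0 ?sqr_ge0 // subr_ge0 ltW // phi_gt1.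
have e2 : \sum_(i in T :\: S) (x - restr T z) i 0 ^+ 2
          = \sum_(i in T :\: S) z i 0 ^+ 2.
  apply: eq_bigr => i; rewrite !inE !mxE => /andP[iS ->].
  by rewrite xS // sub0r sqrrN.
have e2' : \sum_(i in T :\: S) (x - z) i 0 ^+ 2
          = \sum_(i in T :\: S) z i 0 ^+ 2.
  apply: eq_bigr => i; rewrite !inE !mxE => /andP[iS iT].
  by rewrite xS // sub0r sqrrN.
have e3 : \sum_(i in S :&: T) (x - restr T z) i 0 ^+ 2
          = \sum_(i in S :&: T) (x - z) i 0 ^+ 2.
  by apply: eq_bigr => i; rewrite !inE !mxE => /andP[_ ->].
rewrite e2 e3 e2' !mulrDr.
have c0 : 0 <= \sum_(i in S :&: T) (x - z) i 0 ^+ 2.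
  by apply: sumr_ge0 => i _; rewrite sqr_ge0.
(* The mass transferred from [S :\: T] has weight [phi]; added to the weight 1 already on [T :\: S]
   it gives exactly [phi ^+ 2]. *)
apply: (@le_trans _ _ (phi ^+ 2 * (\sum_(i in S :\: T) (x - z) i 0 ^+ 2)
   + phi * \sum_(i in T :\: S) z i 0 ^+ 2 + \sum_(i in T :\: S) z i 0 ^+ 2
   + \sum_(i in S :&: T) (x - z) i 0 ^+ 2)).
  rewrite !lerD2r; apply: le_trans e1 _; rewrite lerD2l.
  by rewrite ler_wpM2l // ltW.
have := mulr_ge0 (ltW phi0) c0; rewrite phi_sq; lra.
Qed.

(** The maximizer is the indicator of the [k] largest coefficients. Both selectors have total [k],
    so subtracting the smallest selected coefficient [t] from every [c i] leaves the difference of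
    the sums unchanged and makes every term nonnegative. *)
Lemma relaxed_selector_max (top : nat -> 'cV[R]_n -> {set 'I_n}) k c w :
  top_rule top -> (0 < k <= n)%N ->
  relaxed_selectors k w ->
  exists L : {set 'I_n}, #|L| = k /\ \sum_i w i 0 * c i <= \sum_(i in L) c i.
Proof.
move=> htop /andP[k0 kn] [sw hw].
(* The rule [top] ranks by magnitude; after a shift by [C] all coefficients are nonnegative and it
   ranks by value. *)
pose C := \sum_i `|c i|.
have cC i : 0 <= c i + C.
  rewrite /C (bigD1 i) //= addrA addr_ge0 ?sumr_ge0 //.
  by have := ler_norm (- c i); rewrite normrN; lra.
pose z : 'cV[R]_n := \col_i (c i + C).
have [cardL hL] := htop k z; rewrite (minn_idPl kn) in cardL.
exists (top k z); split=> //; set L := top k z in cardL hL *.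
have {}hL i j : i \in L -> j \notin L -> c j <= c i.
  by move=> iL jL; have := hL i j iL jL; rewrite !mxE !ger0_norm // lerD2r.
have /card_gt0P[i0 i0L] : (0 < #|L|)%N by rewrite cardL.
case: (arg_minP c i0L) => i1 i1L hi1; set t := c i1.
have sL : \sum_(i in L) c i = \sum_i (i \in L)%:R * c i.
  by rewrite big_mkcond; apply: eq_bigr => i _; case: ifP; rewrite ?mul1r ?mul0r.
have s1 : \sum_i ((i \in L)%:R : R) = k%:R.
  rewrite -cardL -sum1_card natr_sum [RHS]big_mkcond.
  by apply: eq_bigr => i _; case: ifP.
rewrite sL -subr_ge0 -sumrB.
have -> : \sum_i ((i \in L)%:R * c i - w i 0 * c i)
    = \sum_i ((i \in L)%:R - w i 0) * (c i - t).
  rewrite [RHS](eq_bigr (fun i => ((i \in L)%:R * c i - w i 0 * c i)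
     + ((w i 0) * t - (i \in L)%:R * t))); last by move=> i _; ring.
  rewrite [RHS]big_split /= [X in _ = _ + X]sumrB -!big_distrl /= sw s1.
  by rewrite subrr addr0.
apply: sumr_ge0 => i _; have /andP[w0 w1] := hw i.
case: (boolP (i \in L)) => iL.
  by rewrite mulr_ge0 ?subr_ge0 // hi1.
by rewrite sub0r mulNr -mulrN opprB mulr_ge0 ?subr_ge0 // hL.
Qed.

End Thresholding.

(** * Consequences of the restricted isometry property, and least squares *)

Section RIP.
Context {R : realType} {m n : nat}.
Implicit Types (A : 'M[R]_(m, n)) (t k : nat) (d : R) (P T L : {set 'I_n}).

Lemma rip_le A t t' d : (t <= t')%N -> rip A t' d -> rip A t d.
Proof. by move=> tt' [d01 h]; split=> // z /leq_trans/(_ tt')/h. Qed.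

(* The infimum of the admissible constants is admissible. *)
Lemma rip_has_ric A t d : rip A t d -> has_ric A t.
Proof.
move=> hd; have [/andP[d0 d1] _] := hd.
pose E : set R := [set d | rip A t d].
have E0 : E !=set0 by exists d.
have lbE : lbound E 0 by move=> e [/andP[]].
have infd e : E e -> inf E <= e by apply: ge_inf; exists 0.
have inf0 : 0 <= inf E by apply: lb_le_inf.
exists (inf E); split; last exact: infd.
split=> [|z zt]; first by rewrite inf0 (le_lt_trans (infd d hd)).
have [z0|zn0] := eqVneq (norm2 z) 0.
  by have [_ /(_ z zt)] := hd; rewrite z0 expr0n !mulr0.
have N0 : 0 < norm2 z ^+ 2 by rewrite exprn_gt0 // lt_neqAle eq_sym zn0 norm2_ge0.
have lo : 1 - norm2 (A *m z) ^+ 2 / norm2 z ^+ 2 <= inf E.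
  apply: lb_le_inf => // e [_ /(_ z zt)/andP[h _]].
  by rewrite lerBlDr -lerBlDl ler_pdivlMr.
have hi : norm2 (A *m z) ^+ 2 / norm2 z ^+ 2 - 1 <= inf E.
  apply: lb_le_inf => // e [_ /(_ z zt)/andP[_ h]].
  by rewrite lerBlDl ler_pdivrMr.
apply/andP; split; first by rewrite -ler_pdivlMr // lerBlDl -lerBlDr.
by rewrite -ler_pdivrMr // -lerBlDl.
Qed.

Lemma has_ric_le A t t' : (t <= t')%N -> has_ric A t' -> has_ric A t.
Proof. by move=> tt' [d [/(rip_le tt')/rip_has_ric]]. Qed.

Lemma ric_rip A t : has_ric A t -> rip A t (ric A t).
Proof. by move=> /(xgetPex 1)[]. Qed.

Lemma ric_le A t t' : (t <= t')%N -> has_ric A t' -> ric A t <= ric A t'.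
Proof.
move=> tt' h'; have /(xgetPex 1)[_ h] := has_ric_le tt' h'.
by apply: h; apply: rip_le tt' (ric_rip h').
Qed.

Lemma rip_upper A t d (z : 'cV[R]_n) : rip A t d -> (#|supp z| <= t)%N ->
  norm2 (A *m z) <= Num.sqrt (1 + d) * norm2 z.
Proof.
move=> [/andP[d0 _] h] /h/andP[_ hz].
apply: norm2_le; first by rewrite mulr_ge0 ?sqrtr_ge0 ?norm2_ge0.
by rewrite exprMn sqr_sqrtr ?addr_ge0 // -norm2_sq.
Qed.

Lemma rip_lower A t d (z : 'cV[R]_n) : rip A t d -> (#|supp z| <= t)%N ->
  Num.sqrt (1 - d) * norm2 z <= norm2 (A *m z).
Proof.
move=> [/andP[_ d1] h] /h/andP[hz _].
rewrite -ler_sqr ?nnegrE ?mulr_ge0 ?sqrtr_ge0 ?norm2_ge0 //.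
by rewrite exprMn sqr_sqrtr ?subr_ge0 // ltW.
Qed.

(** The quadratic form of [1%:M - A^T *m A] is [norm2 z ^+ 2 - norm2 (A *m z) ^+ 2], which the
    restricted isometry property bounds on vectors supported in [T]. *)
Lemma rip_gram A t d T L (v : 'cV[R]_n) : rip A t d -> (#|T| <= t)%N ->
  L \subset T -> supp v \subset T ->
  norm2 (restr L (v - A^T *m (A *m v))) <= d * norm2 v.
Proof.
move=> hA Tt LT vT; have [/andP[d0 _] h] := hA.
have KE (z : 'cV[R]_n) : (1%:M - A^T *m A) *m z = z - A^T *m (A *m z).
  by rewrite mulmxBl mul1mx mulmxA.
rewrite -KE; apply: (sym_form_restr (T := T)) => // [u u'|z zT].
  by rewrite !KE !dotBr -!dot_mulmxl (dotC u) (dotC (A *m u)).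
rewrite KE dotBr -dot_mulmxl -!norm2_sq.
have /andP[h1 h2] := h z (card_supp zT Tt).
by apply/ler_normlP; split; lra.
Qed.

Lemma sqr_le_cancel (a b : R) : 0 <= a -> 0 <= b -> a ^+ 2 <= b * a -> a <= b.
Proof.
move=> a0 b0; have [->//|an0] := eqVneq a 0.
by rewrite expr2 ler_pM2r // lt_neqAle eq_sym an0.
Qed.

(** By duality: the squared norm of the restricted vector [g] is the inner product of [A *m g] with
    [h], and [g] is sparse. *)
Lemma rip_adjoint A t d L (h : 'cV[R]_m) : rip A t d -> (#|L| <= t)%N ->
  norm2 (restr L (A^T *m h)) <= Num.sqrt (1 + d) * norm2 h.
Proof.
move=> hA Lt; apply: sqr_le_cancel; rewrite ?mulr_ge0 ?sqrtr_ge0 ?norm2_ge0 //.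
set g := restr L _.
have -> : norm2 g ^+ 2 = dot (A *m g) h by rewrite norm2_sq dot_restrK dot_mulmxl.
apply: le_trans (dot_le_norm2 _ _) _.
rewrite mulrAC ler_wpM2r ?norm2_ge0 //.
by apply: (rip_upper hA); apply: card_supp (supp_restr _ _) Lt.
Qed.

Lemma norm2_adjoint A k d (h : 'cV[R]_m) : rip A k d -> (0 < k)%N ->
  norm2 (A^T *m h) <= Num.sqrt (ceil_ratio n k) * (Num.sqrt (1 + d) * norm2 h).
Proof.
move=> hA k0; apply: norm2_blocks => // [|L Lk]; last exact: rip_adjoint hA Lk.
by rewrite mulr_ge0 ?sqrtr_ge0 ?norm2_ge0.
Qed.

(** Only the deviation of [A^T *m (A *m v)] from [v] is cut into blocks, so the block factor
    multiplies [d] alone. Each block joined with [supp v] has at most [k + s] indices. *)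
Lemma norm2_gram A k s t d (v : 'cV[R]_n) : rip A t d -> (0 < k)%N ->
  (#|supp v| <= s)%N -> (k + s <= t)%N ->
  norm2 (A^T *m (A *m v)) <= (1 + Num.sqrt (ceil_ratio n k) * d) * norm2 v.
Proof.
move=> hA k0 vs kst; have [/andP[d0 _] _] := hA.
rewrite -[A^T *m (A *m v)](subKr v).
apply: le_trans (norm2B v (v - A^T *m (A *m v))) _.
rewrite mulrDl mul1r lerD2l -mulrA; apply: norm2_blocks => // [|L Lk].
  by rewrite mulr_ge0 ?norm2_ge0.
apply: (rip_gram (T := L :|: supp v) hA); rewrite ?finset.subsetUl ?finset.subsetUr //.
by rewrite (leq_trans (leq_card_setU _ _)) // (leq_trans _ kst) // leq_add.
Qed.

(** With one copy of [g = A *m hadamard w z] frozen, [norm2 g ^+ 2] is linear in [w], so an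
    indicator of a [k]-element set does at least as well. Cauchy-Schwarz then leaves one factor
    [norm2 g] to cancel. *)
Lemma rip_relaxed_selector A (top : nat -> 'cV[R]_n -> {set 'I_n}) k d
    (w z : 'cV[R]_n) b :
  rip A k d -> top_rule top -> (0 < k <= n)%N -> relaxed_selectors k w ->
  0 <= b -> (forall L, (#|L| <= k)%N -> norm2 (restr L z) <= b) ->
  norm2 (A *m hadamard w z) <= Num.sqrt (1 + d) * b.
Proof.
move=> hA htop hk hw b0 hb; set g := A *m _.
have [L [Lk hL]] := relaxed_selector_max (fun i => z i 0 * (A^T *m g) i 0) htop hk hw.
apply: sqr_le_cancel; rewrite ?mulr_ge0 ?sqrtr_ge0 ?norm2_ge0 //.
have -> : norm2 g ^+ 2 = \sum_i w i 0 * (z i 0 * (A^T *m g) i 0).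
  rewrite norm2_sq {1}/g dot_mulmxl; apply: eq_bigr => i _.
  by rewrite [hadamard _ _ _ _]mxE mulrA.
apply: le_trans hL _; rewrite -dot_restr -dot_mulmxl.
apply: le_trans (dot_le_norm2 _ _) _; rewrite ler_wpM2r ?norm2_ge0 //.
apply: (@le_trans _ _ (Num.sqrt (1 + d) * norm2 (restr L z))).
  by apply: (rip_upper hA); apply: card_supp (supp_restr _ _) _; rewrite Lk.
by rewrite ler_wpM2l ?sqrtr_ge0 // hb ?Lk.
Qed.

(** First-order optimality, obtained by perturbing the minimizer along [g]. *)
Lemma least_squares_orthogonal A (y : 'cV[R]_m) P (z g : 'cV[R]_n) :
  minimizer [set z | supp z \subset P]%classic
    (fun z => norm2 (y - A *m z) ^+ 2) z ->
  supp g \subset P -> dot (y - A *m z) (A *m g) = 0.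
Proof.
move=> [/= zP hz] gP; set r := y - A *m z; set D := dot r _; set G := dot (A *m g) (A *m g).
have G0 : 0 <= G := dot_ge0 _.
(* The optimal step would be [D / G]; the added 1 avoids dividing by zero and still decreases the
   objective by [s ^+ 2 * (G + 2)]. *)
pose s := D / (G + 1).
have DE : D = s * (G + 1) by rewrite divfK // gt_eqF // ltr_wpDl.
have := hz (z + s *: g) (suppD zP (suppZ s gP)).
rewrite mulmxDr -scalemxAr opprD addrA [leRHS]norm2_sq norm2_sq.
rewrite -/r; clearbody r.
rewrite [leRHS](_ : _ = dot r r - 2 * s * D + s ^+ 2 * G); last first.
  by rewrite !(dotBl, dotBr, dotZl, dotZr) (dotC _ r) -/D -/G; ring.
move=> h; have : s ^+ 2 * (G + 2) <= 0.
  rewrite (_ : _ * _ = 2 * s * D - s ^+ 2 * G); last by rewrite DE; ring.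
  by lra.
rewrite pmulr_lle0 ?ltr_wpDl // => s2; have /eqP : s ^+ 2 = 0.
  by apply/le_anti; rewrite s2 sqr_ge0.
by rewrite sqrf_eq0 DE => /eqP ->; rewrite mul0r.
Qed.

(** Completing the square with [s] the root of [1 - d ^+ 2] bounds [(s * e - d * c / s) ^+ 2] by
    [r ^+ 2 + (c / s) ^+ 2], hence by [(r + c / s) ^+ 2]. *)
Lemma quadratic_bound (d c r e : R) : 0 <= d < 1 -> 0 <= c -> 0 <= r ->
  e ^+ 2 <= (d * e + c) ^+ 2 + r ^+ 2 ->
  e <= r / Num.sqrt (1 - d ^+ 2) + c / (1 - d).
Proof.
move=> /andP[d0 d1] c0 r0 h.
have s2p : 0 < 1 - d ^+ 2 by rewrite subr_gt0 exprn_ilt1.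
set s := Num.sqrt _; have s0 : 0 < s by rewrite sqrtr_gt0.
have s2 : s ^+ 2 = 1 - d ^+ 2 by rewrite sqr_sqrtr // ltW.
have sn0 : s != 0 by rewrite gt_eqF.
have cs0 : 0 <= c / s by rewrite divr_ge0 // ltW.
have dn0 : 1 - d != 0 by rewrite gt_eqF // subr_gt0.
have h1 : s * e - d * c / s <= r + c / s.
  apply: ler_normlW; rewrite -[leRHS]ger0_norm ?addr_ge0 // -ler_sqr ?nnegrE //.
  rewrite !real_normK ?num_real //.
  rewrite (_ : _ ^+ 2 = (1 - d ^+ 2) * e ^+ 2 - 2 * d * c * e + (c / s) ^+ 2 - c ^+ 2).
    by have := mulr_ge0 r0 cs0; rewrite sqrrD; lra.
  transitivity (s ^+ 2 * e ^+ 2 - 2 * d * c * e + (c / s) ^+ 2 - (1 - d ^+ 2) * (c / s) ^+ 2).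
    by field.
  by rewrite -s2; field.
have -> : r / s + c / (1 - d) = (r + c / s + d * c / s) / s.
  rewrite !mulrDl -addrA; congr (_ + _).
  have -> : c / s / s + d * c / s / s = c * (1 + d) / s ^+ 2 by field.
  rewrite s2 (_ : 1 - d ^+ 2 = (1 - d) * (1 + d)); last by ring.
  have d1n : 1 + d != 0 by rewrite gt_eqF // ltr_pwDl.
  by field; rewrite dn0 d1n.
by rewrite ler_pdivlMr //; lra.
Qed.

(** The error is split along [P]. Inside [P], orthogonality of the residual leaves a near-isometry
    defect and a noise term; outside [P], both [z] and [v] vanish, so the error there is that of any
    [v] supported in [P]. The resulting inequality is quadratic in the total error. *)
Lemma least_squares_error A (y h : 'cV[R]_m) P T t t' d d'
    (x z v : 'cV[R]_n) :
  rip A t d -> rip A t' d' ->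
  minimizer [set z | supp z \subset P]%classic
    (fun z => norm2 (y - A *m z) ^+ 2) z ->
  y = A *m x + h -> supp x \subset T -> supp v \subset P ->
  (#|P :|: T| <= t)%N -> (#|P| <= t')%N ->
  norm2 (z - x) <= norm2 (x - v) / Num.sqrt (1 - d ^+ 2)
                   + Num.sqrt (1 + d') / (1 - d) * norm2 h.
Proof.
move=> hA hA' hz yE xT vP PTt Pt'; have [d01 _] := hA; have [zP _] := hz.
set e := z - x; set eP := restr P e.
have eT : supp e \subset P :|: T.
  by apply: suppB; [apply: fintype.subset_trans zP (finset.subsetUl _ _)
                   |apply: fintype.subset_trans xT (finset.subsetUr _ _)].
have ePh : norm2 eP <= d * norm2 e + Num.sqrt (1 + d') * norm2 h.
  apply: sqr_le_cancel; rewrite ?addr_ge0 ?mulr_ge0 ?sqrtr_ge0 ?norm2_ge0 //.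
    by case/andP: d01.
  have -> : norm2 eP ^+ 2 = dot eP (e - A^T *m (A *m e)) + dot (A *m eP) h.
    rewrite norm2_sq dot_restrK (dotBr eP e) -dot_mulmxl.
    have := least_squares_orthogonal hz (supp_restr P e).
    rewrite yE (_ : _ - _ = h - A *m e); last by rewrite /e mulmxBr opprB addrA (addrC h).
    by rewrite dotC dotBr -/eP => hd; lra.
  have c1 : dot eP (e - A^T *m (A *m e)) <= norm2 eP * (d * norm2 e).
    rewrite -dot_restrK; apply: le_trans (dot_le_norm2 _ _) _.
    rewrite ler_wpM2l ?norm2_ge0 //.
    exact: (rip_gram hA PTt (finset.subsetUl _ _) eT).
  have c2 : dot (A *m eP) h <= Num.sqrt (1 + d') * norm2 eP * norm2 h.
    apply: le_trans (dot_le_norm2 _ _) _; rewrite ler_wpM2r ?norm2_ge0 //.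
    by apply: (rip_upper hA'); apply: card_supp (supp_restr _ _) Pt'.
  lra.
have eC : norm2 (restr (~: P)%SET e) <= norm2 (x - v).
  have -> : restr (~: P)%SET e = - restr (~: P)%SET (x - v).
    apply/colP => i; rewrite !mxE inE; case: ifPn => [iP|_]; last by rewrite oppr0.
    by rewrite (suppP _ _ zP) // (suppP _ _ vP) //; ring.
  by rewrite norm2N norm2_restr_le.
rewrite mulrAC; apply: quadratic_bound; rewrite ?mulr_ge0 ?sqrtr_ge0 ?norm2_ge0 //.
rewrite (norm2_restrCD P e) lerD // lerXn2r ?nnegrE ?norm2_ge0 //.
by apply: le_trans ePh; apply: norm2_ge0.
Qed.

End RIP.

(** * Spectral bounds for the Newton matrix [D] *)

Section NewtonMatrix.
Context {R : realType} {m n : nat}.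
Variables (A : 'M[R]_(m, n)) (t : nat) (d alpha gamma : R) (Om : {set 'I_n}).
Hypotheses (hA : rip A t d) (Omt : (#|Om| <= t)%N).

Lemma pos_in_enum_val (a : 'I_#|Om|) : pos_in Om (enum_val a) = Some a.
Proof.
rewrite /pos_in; case: pickP => [b /eqP/enum_val_inj -> //|/(_ a)].
by rewrite eqxx.
Qed.

Lemma pos_in_notin i : i \notin Om -> pos_in Om i = None.
Proof.
rewrite /pos_in; case: pickP => // a /eqP <-.
by rewrite enum_valP.
Qed.

Lemma colset_mul (w : 'cV[R]_n) :
  A *m restr Om w = colset A Om *m \col_a w (enum_val a) 0.
Proof.
apply/colP => i; rewrite !mxE.
transitivity (\sum_(j in Om) A i j * w j 0).
  rewrite [RHS]big_mkcond; apply: eq_bigr => j _; rewrite mxE.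
  by case: ifP; rewrite ?mulr0.
by rewrite big_enum_val; apply: eq_bigr => a _; rewrite !mxE.
Qed.

Lemma colset_tr_mul (h : 'cV[R]_m) a :
  ((colset A Om)^T *m h) a 0 = (A^T *m h) (enum_val a) 0.
Proof. by rewrite !mxE; apply: eq_bigr => i _; rewrite !mxE. Qed.

(** A kernel vector of the Gram matrix extends by zero to a sparse vector killed by [A], which the
    lower isometry bound with [d < 1] forces to vanish. *)
Lemma colset_gram_unit : (colset A Om)^T *m colset A Om \in unitmx.
Proof.
set B := colset A Om; rewrite -row_free_unit; apply: inj_row_free => v vG.
pose w : 'cV[R]_n := \col_i (if pos_in Om i is Some a then v 0 a else 0).
have wv : \col_a w (enum_val a) 0 = v^T.
  by apply/colP => a; rewrite !mxE pos_in_enum_val.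
have Bv : B *m v^T = 0.
  apply: norm2_eq0; apply/eqP; rewrite -sqrf_eq0 norm2_sq dot_mulmxl.
  have -> : B^T *m (B *m v^T) = 0.
    by apply: trmx_inj; rewrite mulmxA !trmx_mul !trmxK trmx0.
  by rewrite -[X in dot _ X](scale0r 0) dotZr mul0r.
have := rip_lower hA (card_supp (supp_restr Om w) Omt).
rewrite colset_mul wv Bv norm2_0 pmulr_rle0; last first.
  by rewrite sqrtr_gt0 subr_gt0; case: hA => /andP[].
move=> w0; have /norm2_eq0 w0' : norm2 (restr Om w) = 0.
  by apply/le_anti; rewrite w0 norm2_ge0.
apply/rowP => a; move/colP/(_ (enum_val a)): w0'.
by rewrite !mxE enum_valP pos_in_enum_val.
Qed.

Let D := Mmx A alpha Om *m Zmx gamma Om.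

Lemma newton_entry (z : 'cV[R]_n) i : (D *m z) i 0 =
  \sum_j Mmx A alpha Om i j * ((if j \in Om then 1 else gamma) * z j 0).
Proof.
rewrite /D -mulmxA mxE; apply: eq_bigr => j _; congr (_ * _).
by rewrite mul_diag_mx !mxE.
Qed.

Lemma newton_notin (z : 'cV[R]_n) i :
  i \notin Om -> (D *m z) i 0 = alpha * gamma * z i 0.
Proof.
move=> iOm; rewrite newton_entry (bigD1 i) //= big1 ?addr0 => [|j ji].
  by rewrite (negbTE iOm) mxE pos_in_notin // eqxx mulrA.
rewrite mxE (pos_in_notin iOm) eq_sym (negbTE ji).
by case: pos_in; rewrite mul0r.
Qed.

Lemma newton_in (z : 'cV[R]_n) i :
  i \in Om -> (A^T *m (A *m restr Om (D *m z))) i 0 = z i 0.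
Proof.
move=> iOm; rewrite -(enum_rankK_in iOm iOm); set a := enum_rank_in _ _.
rewrite -colset_tr_mul colset_mul.
set G := (colset A Om)^T *m colset A Om.
(* On the indices of [Om], [D] reads only the entries of [z] in [Om], through the inverse Gram
   matrix. *)
have -> : \col_b (D *m z) (enum_val b) 0 = invmx G *m \col_b z (enum_val b) 0.
  apply/colP => b; rewrite mxE newton_entry [RHS]mxE.
  rewrite (bigID (mem Om)) /= [X in _ + X]big1 ?addr0 => [|j jOm]; last first.
    by rewrite mxE pos_in_enum_val pos_in_notin ?mul0r.
  rewrite big_enum_val; apply: eq_bigr => c _.
  by rewrite !mxE !pos_in_enum_val enum_valP mul1r.
by rewrite mulmxA mulmxA mulmxV ?colset_gram_unit // mul1mx mxE.
Qed.

Lemma newton_restr (z : 'cV[R]_n) :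
  restr Om (A^T *m (A *m restr Om (D *m z))) = restr Om z.
Proof.
apply/colP => i; rewrite [LHS]mxE [RHS]mxE.
by case: ifP => // /newton_in ->.
Qed.

(** The inverse Gram matrix is absorbed by writing [restr Om u] as the Gram matrix applied to
    [restr Om (D *m u)]. Symmetry of [D] becomes visible. *)
Lemma newton_form (u z : 'cV[R]_n) : dot u (D *m z) =
  dot (A *m restr Om (D *m u)) (A *m restr Om (D *m z))
  + alpha * gamma * dot (restr (~: Om)%SET u) (restr (~: Om)%SET z).
Proof.
have zE : restr (~: Om)%SET (D *m z) = (alpha * gamma) *: restr (~: Om)%SET z.
  apply/colP => i; rewrite mxE [RHS]mxE [in RHS]mxE inE.
  by case: ifP => [/newton_notin|_]; rewrite ?mulr0.
rewrite {1}(restrCD Om (D *m z)) dotDr zE dotZr; congr (_ + _ * _); rewrite dotC.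
  by rewrite -dot_restrK -(newton_restr u) dot_restrK -dot_mulmxl dotC.
by rewrite -dot_restrK dotC.
Qed.

Lemma newton_form_bounds (z : 'cV[R]_n) :
  (1 + d)^-1 <= alpha * gamma <= (1 - d)^-1 ->
  (1 + d)^-1 * norm2 z ^+ 2 <= dot z (D *m z) <= (1 - d)^-1 * norm2 z ^+ 2.
Proof.
move=> /andP[lo hi]; have [/andP[d0 d1] h] := hA.
have dp : 0 < 1 + d by rewrite ltr_pwDl.
have dm : 0 < 1 - d by rewrite subr_gt0.
rewrite newton_form -!norm2_sq (norm2_restrCD Om z) !mulrDr.
set w := restr Om (D *m z); set q := norm2 (A *m w) ^+ 2.
(* [q] is the part of the form living on [Om]; comparing it with [norm2 (restr Om z) ^+ 2] bounds
   the spectrum of the inverse Gram matrix. *)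
have qE : q = dot (restr Om z) w.
  by rewrite dotC -(newton_restr z) [RHS]dot_restrK -dot_mulmxl -norm2_sq.
have Nq : norm2 (restr Om z) ^+ 2 <= (1 + d) * q.
  have r0 : 0 <= Num.sqrt (1 + d) * norm2 (A *m w).
    by rewrite mulr_ge0 ?sqrtr_ge0 ?norm2_ge0.
  have := lerXn2r 2 (norm2_ge0 _) r0 (rip_adjoint (A *m w) hA Omt).
  by rewrite newton_restr exprMn (sqr_sqrtr (ltW dp)).
have qN : (1 - d) * q <= norm2 (restr Om z) ^+ 2.
  have /andP[wq _] := h w (card_supp (supp_restr _ _) Omt); rewrite -/q in wq.
  (* Expanding this square and using [(1 - d) * norm2 w ^+ 2 <= q] yields the upper bound on [q]
     without any spectral theorem. *)
  have := dot_ge0 (restr Om z - (1 - d) *: w).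
  rewrite !(dotBl, dotBr, dotZl, dotZr) (dotC w) -!norm2_sq -qE.
  by have := ler_wpM2l (ltW dm) wq; lra.
have C0 := sqr_ge0 (norm2 (restr (~: Om)%SET z)).
apply/andP; split; apply: lerD; rewrite ?ler_wpM2r //.
  by rewrite ler_pdivrMl.
by rewrite ler_pdivlMl.
Qed.

Lemma newton_sym (u z : 'cV[R]_n) : dot u (D *m z) = dot z (D *m u).
Proof.
by rewrite !newton_form dotC; congr (_ + _ * _); rewrite dotC.
Qed.

Lemma newton_norm (z : 'cV[R]_n) :
  (1 + d)^-1 <= alpha * gamma <= (1 - d)^-1 ->
  norm2 (D *m z) <= (1 - d)^-1 * norm2 z.
Proof.
move=> hag; have [/andP[d0 d1] h] := hA.
have hi0 : 0 <= (1 - d)^-1 by rewrite invr_ge0 subr_ge0 ltW.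
rewrite -(restr_id (finset.subsetT (supp (D *m z)))).
apply: (sym_form_restr (T := [set: 'I_n]%SET)) => // [|z' _]; first exact: newton_sym.
have /andP[lo hi] := newton_form_bounds z' hag.
rewrite ger0_norm //; apply: le_trans lo.
by rewrite mulr_ge0 ?sqr_ge0 // invr_ge0 addr_ge0.
Qed.

(** The form of [1%:M - lambda *: D] lies between [1 - lambda / (1 - d)] and [1 - lambda / (1 + d)]
    times the squared norm, and [Delta] is the larger of their absolute values. *)
Lemma newton_contraction (lambda : R) (z : 'cV[R]_n) : 0 <= lambda ->
  (1 + d)^-1 <= alpha * gamma <= (1 - d)^-1 ->
  norm2 (z - lambda *: (D *m z)) <= Delta lambda d * norm2 z.
Proof.
move=> l0 hag; have [/andP[d0 d1] h] := hA.
have KE (u : 'cV[R]_n) : (1%:M - lambda *: D) *m u = u - lambda *: (D *m u).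
  by rewrite mulmxBl mul1mx -scalemxAl.
rewrite -KE -(restr_id (finset.subsetT (supp (_ *m z)))).
apply: (sym_form_restr (T := [set: 'I_n]%SET)) => // [|u u'|u _].
- by rewrite le_max normr_ge0.
- by rewrite !KE !dotBr !dotZr newton_sym dotC.
have /andP[lo hi] := newton_form_bounds u hag.
rewrite KE dotBr dotZr -norm2_sq.
set N := norm2 u ^+ 2 in lo hi *; have N0 : 0 <= N by apply: sqr_ge0.
clearbody N.
have := ler_wpM2l l0 lo; have := ler_wpM2l l0 hi; rewrite !mulrA => h1 h2.
have a1 : - (1 - lambda / (1 - d)) <= Delta lambda d.
  by apply: (@le_trans _ _ `|1 - lambda / (1 - d)|);
     rewrite ?le_max ?lexx // -normrN ler_norm.
have a2 : 1 - lambda / (1 + d) <= Delta lambda d.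
  by apply: (@le_trans _ _ `|1 - lambda / (1 + d)|);
     rewrite ?le_max ?lexx ?orbT // ler_norm.
have h3 := ler_wpM2r N0 a1; have h4 := ler_wpM2r N0 a2.
rewrite mulNr mulrBl mul1r in h3; rewrite mulrBl mul1r in h4.
by apply/ler_normlP; split; lra.
Qed.

End NewtonMatrix.

(** * Error propagation through one iteration *)

Section Step.
Context {R : realType} {m n : nat}.
Variables (A : 'M[R]_(m, n)) (k q : nat) (lambda alpha gamma : R).
Variables (dk d2 d3 dq : R).
Hypotheses (k0 : (0 < k <= n)%N).
Hypotheses (hAk : rip A k dk) (hA2 : rip A (2 * k) d2) (hA3 : rip A (3 * k) d3).
Hypotheses (hAq : rip A q dq) (l0 : 0 <= lambda) (dk2 : dk <= d2).
Hypothesis hag : (1 + dq)^-1 <= alpha * gamma <= (1 - dq)^-1.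

Let sc : R := Num.sqrt (ceil_ratio n k).
(** [rho] and [nu] are the gains of the error and of the noise in the Newton step alone, before
    selection, thresholding and projection multiply them. *)
Let rho := d3 + Delta lambda dq * (1 + sc * d3).
Let nu := lambda / (1 - dq) * (sc * Num.sqrt (1 + dk)).

(* With [v = xp - x] and [D = M Z], the error after the Newton step is
   [(v - A^T A v) + (A^T A v - lambda D A^T A v) + lambda D A^T h]. *)
Lemma newton_step_error (y h : 'cV[R]_m) (x xp : 'cV[R]_n) (Om L : {set 'I_n}) :
  y = A *m x + h -> (#|Om| <= q)%N -> (#|L| <= k)%N ->
  (#|supp (xp - x)| <= 2 * k)%N ->
  norm2 (restr L (xp + lambda *: (Mmx A alpha Om *m Zmx gamma Om
                     *m (A^T *m (y - A *m xp))) - x))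
    <= rho * norm2 (xp - x) + nu * norm2 h.
Proof.
move=> -> Omq Lk v2; set v := xp - x in v2 *; set D := _ *m Zmx _ _.
have [/andP[_ dq1] _] := hAq; have [k1 _] := andP k0.
have -> : xp + lambda *: (D *m (A^T *m (A *m x + h - A *m xp))) - x
    = (v - A^T *m (A *m v))
      + (A^T *m (A *m v) - lambda *: (D *m (A^T *m (A *m v))))
      + lambda *: (D *m (A^T *m h)).
  have -> : A *m x + h - A *m xp = h - A *m v.
    by rewrite /v mulmxBr opprB addrA (addrC h).
  rewrite (mulmxBr A^T h) (mulmxBr D) scalerBr.
  have split_error (a b c : 'cV[R]_n) : xp + (a - b) - x = (v - c) + (c - b) + a.
    by apply/colP => i; rewrite /v !mxE; ring.
  exact: split_error.
rewrite 2!restrD.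
have b1 : norm2 (restr L (v - A^T *m (A *m v))) <= d3 * norm2 v.
  apply: (rip_gram (T := L :|: supp v) hA3);
    rewrite ?finset.subsetUl ?finset.subsetUr //.
  by rewrite (leq_trans (leq_card_setU _ _)) // -[3%N]/(1 + 2)%N mulnDl mul1n leq_add.
have b2 : norm2 (restr L (A^T *m (A *m v) - lambda *: (D *m (A^T *m (A *m v)))))
    <= Delta lambda dq * ((1 + sc * d3) * norm2 v).
  apply: le_trans (norm2_restr_le _ _) _.
  apply: le_trans (newton_contraction hAq Omq _ l0 hag) _.
  rewrite ler_wpM2l ?le_max ?normr_ge0 //.
  by apply: (norm2_gram hA3 k1 v2); rewrite -[3%N]/(1 + 2)%N mulnDl mul1n.
have b3 : norm2 (restr L (lambda *: (D *m (A^T *m h)))) <= nu * norm2 h.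
  apply: le_trans (norm2_restr_le _ _) _.
  rewrite norm2Z ger0_norm // /nu -!mulrA ler_wpM2l //.
  apply: le_trans (newton_norm hAq Omq _ hag) _.
  by rewrite ler_wpM2l ?invr_ge0 ?subr_ge0 ?(ltW dq1) // norm2_adjoint.
apply: le_trans (norm2D _ _) _; apply: lerD b3.
apply: le_trans (norm2D _ _) _.
have -> : rho * norm2 v = d3 * norm2 v + Delta lambda dq * ((1 + sc * d3) * norm2 v).
  by rewrite /rho; ring.
exact: lerD.
Qed.

(* The competitor in the selection problem is the indicator vector of [S]. *)
Lemma selection_error (top : nat -> 'cV[R]_n -> {set 'I_n})
    (y h : 'cV[R]_m) (x u w : 'cV[R]_n) (S T : {set 'I_n}) b :
  top_rule top -> y = A *m x + h -> supp x \subset S -> #|S| = k ->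
  S \subset T -> (#|T| <= 2 * k)%N -> 0 <= b ->
  minimizer (relaxed_selectors k)
    (fun v => norm2 (y - A *m hadamard v u) ^+ 2) w ->
  (forall L : {set 'I_n}, (#|L| <= k)%N -> norm2 (restr L (u - x)) <= b) ->
  Num.sqrt (1 - d2) * norm2 (restr T (x - hadamard w u))
    <= 2 * norm2 h + 2 * (Num.sqrt (1 + dk) * b).
Proof.
move=> htop yE xS Sk ST T2 b0 [hw wmin] hb.
pose w' : 'cV[R]_n := \col_i (i \in S)%:R.
have hw' : relaxed_selectors k w'.
  split=> [|i]; last by rewrite mxE; case: (i \in S); rewrite ?lexx ?ler01.
  rewrite -Sk -sum1_card natr_sum [RHS]big_mkcond; apply: eq_bigr => i _.
  by rewrite mxE; case: ifP.
have := wmin w' hw'.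
rewrite ler_sqr ?nnegrE ?norm2_ge0 // => hmin.
have w'b : norm2 (y - A *m hadamard w' u) <= norm2 h + Num.sqrt (1 + dk) * b.
  have -> : y - A *m hadamard w' u = h - A *m restr S (u - x).
    rewrite yE addrAC -mulmxBr addrC -mulmxN; congr (_ + A *m _).
    apply/colP => i; rewrite !mxE; case: ifPn => [_|/(suppP _ _ xS) ->];
      rewrite ?mul1r ?mul0r; ring.
  apply: le_trans (norm2B _ _) _; rewrite lerD2l.
  apply: le_trans (rip_upper hAk (card_supp (supp_restr _ _) _)) _; first by rewrite Sk.
  by rewrite ler_wpM2l ?sqrtr_ge0 // hb // Sk.
(* The fractional selector [w] may act on all of the complement of [T], which is not sparse; the
   bound on the polytope replaces sparsity. *)
have wT : norm2 (A *m hadamard w (restr (~: T)%SET (u - x)))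
    <= Num.sqrt (1 + dk) * b.
  apply: (rip_relaxed_selector hAk htop k0 hw b0) => L Lk.
  apply: le_trans (hb L Lk).
  have -> : restr L (restr (~: T)%SET (u - x)) = restr (~: T)%SET (restr L (u - x)).
    by apply/colP => i; rewrite !mxE; case: ifP; case: ifP.
  exact: norm2_restr_le.
apply: le_trans (rip_lower hA2 (card_supp (supp_restr _ _) T2)) _.
(* Since [x] vanishes off [T], passing from [x - hadamard w u] to its part on [T] only adds back the
   selected Newton error off [T]. *)
have -> : A *m restr T (x - hadamard w u)
    = (y - A *m hadamard w u) - h + A *m hadamard w (restr (~: T)%SET (u - x)).
  have -> : y - A *m hadamard w u - h = A *m (x - hadamard w u).
    by rewrite yE mulmxBr addrAC addrK.
  rewrite -mulmxDr; congr (A *m _); apply/colP => i; rewrite !mxE !inE.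
  case: ifPn => iT /=; first by ring.
  have -> : x i 0 = 0 by apply: (suppP _ _ xS); apply: contra iT; apply: (fintype.subsetP ST).
  by ring.
apply: le_trans (norm2D _ _) _.
have := norm2B (y - A *m hadamard w u) h.
by lra.
Qed.

(** Chains four bounds: least squares in terms of the thresholded vector, thresholding in terms of
    [x - z] on [S :|: T], selection in terms of [b], and the Newton step for [b]. *)
Lemma cnotp_step_error (top : nat -> 'cV[R]_n -> {set 'I_n})
    (y h : 'cV[R]_m) (x xp xp1 : 'cV[R]_n) (S : {set 'I_n}) :
  top_rule top -> y = A *m x + h -> supp x \subset S -> #|S| = k ->
  (#|supp xp| <= k)%N ->
  cnotp_step top A y k q lambda alpha gamma xp xp1 ->
  norm2 (xp1 - x)
    <= 3 * phi / (1 - d2) * rho * norm2 (xp - x)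
     + (3 * lambda * phi * (1 + dk) * sc
         / ((1 - dq) * (1 - d2) * Num.sqrt (1 + d2))
       + 2 * phi / ((1 - d2) * Num.sqrt (1 + d2))
       + Num.sqrt (1 + dk) / (1 - d2)) * norm2 h.
Proof.
move=> htop yE xS Sk xpk [w [hw hx]].
set Om := topsupp _ _ _ in hw hx; set u := xp + _ in hw hx.
set z := hadamard w u in hw hx; set P := supp _ in hx; set T := top k z.
have [k1 kn] := andP k0; have [/andP[d20 d21] _] := hA2.
have [/andP[d30 _] _] := hA3; have [/andP[dq0 dq1] _] := hAq.
have [/andP[dk0 _] _] := hAk.
have [cT hT] := htop k z; rewrite (minn_idPl kn) -/T in cT hT.
(* [T] has exactly [k] elements, while the support [P] of the thresholded vector may be smaller:
   thresholding is analyzed on [T], least squares on [P]. *)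
have PT : P \subset T by apply: supp_restr.
have Omq : (#|Om| <= q)%N.
  apply: card_supp (supp_restr _ _) _.
  by have [-> _] := htop q (A^T *m (y - A *m xp)); rewrite geq_minl.
have k2 (U V : {set 'I_n}) : (#|U| <= k -> #|V| <= k -> #|U :|: V| <= 2 * k)%N.
  move=> Uk Vk; rewrite mul2n -addnn.
  by rewrite (leq_trans (leq_card_setU _ _)) ?leq_add.
have v2 : (#|supp (xp - x)| <= 2 * k)%N.
  apply: card_supp (k2 (supp xp) S xpk _); last by rewrite Sk.
  by apply: suppB; [exact: finset.subsetUl
    | apply: fintype.subset_trans xS (finset.subsetUr _ _)].
have sc0 : 0 <= sc by apply: sqrtr_ge0.
have rho0 : 0 <= rho.
  rewrite addr_ge0 // mulr_ge0 ?le_max ?normr_ge0 //.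
  by rewrite addr_ge0 // mulr_ge0.
have nu0 : 0 <= nu.
  by rewrite !mulr_ge0 ?sqrtr_ge0 // invr_ge0 subr_ge0 ltW.
set V := norm2 (xp - x); set b := rho * V + nu * norm2 h.
have V0 : 0 <= V := norm2_ge0 _.
have h0 : 0 <= norm2 h := norm2_ge0 _.
have b0 : 0 <= b by apply: addr_ge0; apply: mulr_ge0.
have hb (L : {set 'I_n}) : (#|L| <= k)%N -> norm2 (restr L (u - x)) <= b.
  by move=> Lk; apply: newton_step_error.
have T2 : (#|S :|: T| <= 2 * k)%N by rewrite k2 ?Sk ?cT.
have e3 := selection_error htop yE xS Sk (finset.subsetUl S T) T2 b0 hw hb.
have e2 : norm2 (x - restr T z) <= phi * norm2 (restr (S :|: T) (x - z)).
  by apply: hard_threshold_le; rewrite ?Sk ?cT.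
have Pk : (#|P| <= k)%N by rewrite -cT subset_leq_card.
have e1 : norm2 (xp1 - x) <= norm2 (x - restr T z) / Num.sqrt (1 - d2 ^+ 2)
    + Num.sqrt (1 + dk) / (1 - d2) * norm2 h.
  by apply: (least_squares_error hA2 hAk hx yE xS); rewrite ?k2 ?Sk.
apply: le_trans e1 _; rewrite -/z in e3; rewrite (mulrDl _ _ (norm2 h)) addrA; apply: lerD => //.
set X := norm2 (restr _ _) in e2 e3.
have p0 := @phi_gt0 R.
have -> : Num.sqrt (1 - d2 ^+ 2) = Num.sqrt (1 - d2) * Num.sqrt (1 + d2).
  by rewrite -sqrtrM ?subr_ge0 ?ltW //; congr Num.sqrt; ring.
have a2 : Num.sqrt (1 - d2) ^+ 2 = 1 - d2 by rewrite sqr_sqrtr // subr_ge0 ltW.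
have ap : 0 < Num.sqrt (1 - d2) by rewrite sqrtr_gt0 subr_gt0.
have cp : 0 < Num.sqrt (1 + d2) by rewrite sqrtr_gt0 ltr_pwDl.
have ec : Num.sqrt (1 + dk) <= Num.sqrt (1 + d2) by rewrite ler_sqrt ?addr_ge0 // lerD2l.
have e20 : Num.sqrt (1 + dk) ^+ 2 = 1 + dk by rewrite sqr_sqrtr // addr_ge0.
have e0 : 0 <= Num.sqrt (1 + dk) by apply: sqrtr_ge0.
have nuE : nu = lambda / (1 - dq) * (sc * Num.sqrt (1 + dk)) by [].
have bE : b = rho * V + nu * norm2 h by [].
have dqn : 1 - dq != 0 by rewrite gt_eqF // subr_gt0.
set a := Num.sqrt (1 - d2) in a2 ap e3 *; set c := Num.sqrt (1 + d2) in cp ec *.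
set e := Num.sqrt (1 + dk) in ec e20 e0 e3 nuE *.
(* With [1 + dk] and [1 - d2] written as squares of [e] and [a], the final comparison is a rational
   identity. *)
rewrite -e20 -a2; clearbody b a c e nu rho sc X V.
have an : a != 0 by rewrite gt_eqF.
have cn : c != 0 by rewrite gt_eqF.
rewrite ler_pdivrMr ?mulr_gt0 //; apply: le_trans e2 _.
rewrite -(ler_pM2l ap) mulrCA.
(* The constant 2 from the selection bound is relaxed to the 3 of the stated rate. Next, [e <= c] is
   used on the error term only; on the noise term [e] is kept, to pair with the [e] inside [nu] and
   give [1 + dk]. *)
apply: (@le_trans _ _ (phi * (2 * norm2 h + 3 * (e * b)))).
  rewrite ler_pM2l //; apply: le_trans e3 _; rewrite lerD2l ler_wpM2r //.
    by rewrite mulr_ge0.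
  by rewrite ler_nat.
apply: (@le_trans _ _ (phi * (2 * norm2 h + 3 * (c * (rho * V) + e * (nu * norm2 h))))).
  rewrite ler_pM2l // lerD2l ler_pM2l // bE mulrDr lerD2r ler_wpM2r //.
  by rewrite mulr_ge0.
rewrite le_eqVlt; apply/orP; left; apply/eqP; rewrite nuE; field.
by rewrite an cn.
Qed.

End Step.

(** * Choice of the step length, convergence, and the theorem *)

(** The two bounds on [lambda] say that [lambda / (1 + d)] exceeds [1 - mu] and [lambda / (1 - d)]
    is below [1 + mu]; as the former quotient is at most the latter, both lie within [mu] of 1. *)
Lemma Delta_lt (R : realType) (lambda d mu : R) : 0 <= d < 1 -> mu < 1 ->
  (1 + d) * (1 - mu) < lambda < (1 - d) * (1 + mu) -> Delta lambda d < mu.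
Proof.
move=> /andP[d0 d1] mu1 /andP[lo hi].
have dp : 0 < 1 + d by rewrite ltr_pwDl.
have dm : 0 < 1 - d by rewrite subr_gt0.
have mu0 : 0 < mu by have := lt_trans lo hi; nra.
have a1 : lambda / (1 - d) < 1 + mu by rewrite ltr_pdivrMr // mulrC.
have a2 : 1 - mu < lambda / (1 + d) by rewrite ltr_pdivlMr // mulrC.
have l0 : 0 < lambda by apply: lt_trans lo; rewrite mulr_gt0 // subr_gt0.
have le : lambda / (1 + d) <= lambda / (1 - d).
  by rewrite ler_pM2l // lef_pV2 ?posrE //; lra.
by rewrite gt_max; apply/andP; split; apply/ltr_normlP; split; lra.
Qed.

Lemma cvg_norm2 (R : realType) n (xs : nat -> 'cV[R]_n) (x : 'cV[R]_n) rho :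
  0 <= rho < 1 ->
  (forall p, norm2 (xs p.+1 - x) <= rho * norm2 (xs p - x)) ->
  xs @ \oo --> x.
Proof.
move=> /andP[r0 r1] h.
have hp p : norm2 (xs p - x) <= rho ^+ p * norm2 (xs 0%N - x).
  elim: p => [|p IH]; first by rewrite expr0 mul1r.
  by apply: le_trans (h p) _; rewrite exprS -mulrA ler_wpM2l.
have c0 : (fun p => rho ^+ p * norm2 (xs 0%N - x)) @ \oo --> (0 : R).
  rewrite -[X in _ --> X](mul0r (norm2 (xs 0%N - x))); apply: cvgMl.
  by apply: cvg_expr; rewrite ger0_norm.
(* Balls of matrices are entrywise, so the geometric bound on [norm2] controls each entry. *)
apply/cvg_ballP => e e0.
near=> p; split=> // i j.
have pe : rho ^+ p * norm2 (xs 0%N - x) < e by near: p; exact: cvgr_lt c0 _ e0.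
rewrite -ball_normE /= (ord1 j) distrC.
apply: le_lt_trans (le_lt_trans (hp p) pe).
by have := norm2_entry (xs p - x) i; rewrite !mxE.
Unshelve. all: by end_near.
Qed.

Theorem theorem3p9 (R : realType) (m n : nat) (hmn : (m < n)%N)
    (A : 'M[R]_(m, n)) (k q : nat) (hk : (0 < k)%N) (hq : (k <= q)%N)
    (top : nat -> 'cV[R]_n -> {set 'I_n}) (htop : top_rule top)
    (x : 'cV[R]_n) (eta : 'cV[R]_m)
    (y : 'cV[R]_m) (hy : y = A *m x + eta)
    (S : {set 'I_n}) (hS : S = topsupp top k x)
    (hex : has_ric A (maxn q (3 * k)))
    (hric : ric A (maxn q (3 * k)) < ric_bound n k)
    (lambda alpha gamma : R)
    (hlambda : (1 + ric A q) * (1 - step_margin A k) < lambda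
               < (1 - ric A q) * (1 + step_margin A k))
    (halpha : 0 < alpha) (hgamma : 0 < gamma)
    (hag : (1 + ric A q)^-1 <= alpha * gamma <= (1 - ric A q)^-1)
    (eta' : 'cV[R]_m) (heta' : eta' = A *m restr (~: S)%SET x + eta)
    (xs : nat -> 'cV[R]_n)
    (hxs : cnotp_sequence top A y k q lambda alpha gamma xs) :
  [/\ forall p : nat,
        norm2 (xs p.+1 - restr S x)
          <= rho4 A k q lambda * norm2 (xs p - restr S x)
             + tau4 A k q lambda * norm2 eta',
      rho4 A k q lambda < 1
    & eta' = 0 -> xs @ \oo --> restr S x].
Proof.
have [x0 step] := hxs.
(* Feasibility of the first selector: [n] entries, each at most 1, sum to [k]. *)
have kn : (k <= n)%N.
  have [w [[[sw hw] _] _]] := step 0%N.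
  rewrite -(ler_nat R) -sw -[n in n%:R]card_ord -sumr_const.
  by apply: ler_sum => i _; have /andP[] := hw i.
have ex t : (t <= maxn q (3 * k))%N -> has_ric A t by move/has_ric_le; apply.
have exq : has_ric A q by apply: ex; rewrite leq_maxl.
have ex3 : has_ric A (3 * k) by apply: ex; rewrite leq_maxr.
have ex2 : has_ric A (2 * k) by apply: has_ric_le ex3; rewrite leq_mul2r orbT.
have exk : has_ric A k by apply: has_ric_le exq.
have rq := ric_rip exq; have r3 := ric_rip ex3; have r2 := ric_rip ex2.
have rk := ric_rip exk.
have dk2 : ric A k <= ric A (2 * k) by apply: ric_le ex2; rewrite leq_pmull.
have [dq01 _] := rq; have [/andP[d30 d31] _] := r3; have [/andP[d20 d21] _] := r2.
have p1 := @phi_gt1 R; have p0 := @phi_gt0 R.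
have sc0 : 0 <= Num.sqrt (ceil_ratio n k) :> R by apply: sqrtr_ge0.
have den : 1 <= 1 + Num.sqrt (ceil_ratio n k) * ric A (3 * k).
  by rewrite lerDl mulr_ge0.
have den0 := lt_le_trans ltr01 den.
(* Together with [1 + ric A q > 0], this makes the lower end of the interval for [lambda]
   positive. *)
have mu1 : step_margin A k < 1.
  rewrite ltr_pdivrMr // mul1r; apply: lt_le_trans den.
  rewrite ltrBlDr mulrC ltr_pdivrMr ?mulr_gt0 //; nra.
have DeltaP := Delta_lt dq01 mu1 hlambda.
have l0 : 0 <= lambda.
  have /andP[lo _] := hlambda; apply: ltW; apply: lt_trans lo.
  by have /andP[dq0 _] := dq01; rewrite mulr_gt0 ?subr_gt0 // ltr_pwDl.
(* Clearing denominators in [Delta lambda (ric A q) < step_margin A k] gives exactly this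
   inequality. *)
have rho1 : rho4 A k q lambda < 1.
  move: DeltaP; rewrite ltr_pdivlMr // => DeltaP.
  rewrite /rho4 mulrAC ltr_pdivrMr ?subr_gt0 // mul1r.
  rewrite mulrC -ltr_pdivlMr ?mulr_gt0 // mulrC; lra.
have rho0 : 0 <= rho4 A k q lambda.
  apply: mulr_ge0; first by rewrite divr_ge0 ?mulr_ge0 ?subr_ge0 // ltW.
  by rewrite addr_ge0 // mulr_ge0 ?(ltW den0) // le_max normr_ge0.
have cardT z : #|top k z| = k by have [-> _] := htop k z; apply/minn_idPl.
(* [S] has fewer than [k] elements when [x] has few nonzero entries; the comparison set is therefore
   [top k x], whose indicator has total [k]. *)
have ST : S \subset top k x by rewrite hS; apply: supp_restr.
(* The tail of [x] outside [S] is moved into the noise, leaving an exactly sparse target. *)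
have yE : y = A *m restr S x + eta'.
  by rewrite hy heta' {1}(restrCD S x) mulmxDr addrA.
have supp_k p : (#|supp (xs p)| <= k)%N.
  case: p => [|p].
    rewrite x0 (_ : supp _ = finset.set0) ?cards0 //.
    by apply/setP => i; rewrite !inE mxE eqxx.
  have [w [_ [/= sub _]]] := step p.
  apply: card_supp (fintype.subset_trans sub (supp_restr _ _)) _.
  by rewrite cardT.
have main p : norm2 (xs p.+1 - restr S x)
    <= rho4 A k q lambda * norm2 (xs p - restr S x)
       + tau4 A k q lambda * norm2 eta'.
  have hkn : (0 < k <= n)%N by rewrite hk.
  apply: (cnotp_step_error hkn rk r2 r3 rq l0 dk2 hag htop yE _ (cardT x)
            (supp_k p) (step p)).
  exact: fintype.subset_trans (supp_restr _ _) ST.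
split=> // eta0; apply: (cvg_norm2 (rho := rho4 A k q lambda)) => [|p].
  by rewrite rho0.
by have := main p; rewrite eta0 norm2_0 mulr0 addr0.
Qed.
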